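(* Let $G$ be a finite solvable group and let $p$ be a prime. Then $G$ has a normal Sylow $p$-subgroup if and only if, for every monomial irreducible $p$-Brauer character $\varphi \in {\rm IBr}(G)$, the prime $p$ does not divide the degree $\varphi(1)$.
   Context: For a finite group $G$ and a prime $p$, ${\rm IBr}(G)$ denotes the set of irreducible $p$-Brauer characters of $G$, i.e. the Brauer characters (complex-valued class functions on the $p$-regular elements of $G$) afforded by the irreducible representations of $G$ over an algebraically closed field of characteristic $p$. The degree $\varphi(1)$ is the dimension of the corresponding representation. A Brauer character $\varphi \in {\rm IBr}(G)$ is called monomial if there exist a subgroup $H \le G$ (possibly $H = G$) and a linear (i.e. degree one) Brauer character $\mu \in {\rm IBr}(H)$ such that $\varphi = \mu^{G}$, the Brauer character induced from $\mu$. *)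

(* Defs.v *)
From HB Require Import structures.
From mathcomp Require Import all_boot all_order all_algebra all_fingroup.
From mathcomp Require Import all_solvable all_field all_character.

Set Implicit Arguments.
Unset Strict Implicit.
Unset Printing Implicit Defensive.

Import GroupScope GRing.Theory.
Local Open Scope ring_scope.

(* The choice underlying the Brauer characters in characteristic p: theta     *)
(* restricts to an injective homomorphism from the group of roots of unity of *)
(* F into the roots of unity of algC (its other values are irrelevant). When  *)
(* F is algebraically closed of characteristic p, the roots of unity of F all *)
(* have order prime to p, and theta is then an isomorphism onto the complex   *)
(* roots of unity of order prime to p. Two roots of unity always lie in a     *)
(* common group of n-th roots of unity.                                       *)
Definition brauer_lift (F : closedFieldType) (theta : F -> algC) : Prop :=
  theta 1 = 1 /\
  forall n : nat, (0 < n)%N ->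
    {in n.-unity_root &, {morph theta : x y / x * y}} /\
    {in n.-unity_root &, injective theta}.

(* Listed with their multiplicities. *)
Definition eigenvalues (F : closedFieldType) (n : nat) (A : 'M[F]_n) : seq F :=
  sval (closed_field_poly_normal (char_poly A)).

Lemma eigenvaluesP (F : closedFieldType) (n : nat) (A : 'M[F]_n) :
  char_poly A = \prod_(a <- eigenvalues A) ('X - a%:P).
Proof.
rewrite /eigenvalues; case: closed_field_poly_normal => r /= ->.
suff -> : lead_coef (char_poly A) = 1 by rewrite scale1r.
exact/monicP/char_poly_monic.
Qed.

Lemma char_poly_conj (R : comUnitRingType) (n : nat) (A P : 'M[R]_n) :
  P \in unitmx -> char_poly (invmx P *m A *m P) = char_poly A.
Proof.
move=> uP; rewrite /char_poly.
have PK : map_mx polyC (invmx P) *m map_mx polyC P = 1%:M.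
  by rewrite -map_mxM mulVmx // map_mx1.
have -> : char_poly_mx (invmx P *m A *m P) =
    map_mx polyC (invmx P) *m char_poly_mx A *m map_mx polyC P.
  rewrite /char_poly_mx mulmxBr mulmxBl !map_mxM; congr (_ - _).
  by rewrite scalar_mxC -mulmxA PK mulmx1.
by rewrite !det_mulmx mulrAC -det_mulmx PK det1 mul1r.
Qed.

Section BrauerCharacters.

Variables (gT : finGroupType) (p : nat) (F : closedFieldType).
Variable theta : F -> algC.

Fact cfBrauer_subproof (G : {group gT}) n (rG : mx_representation F G n) :
  is_class_fun <<G>>
    [ffun x => (\sum_(a <- eigenvalues (rG x)) theta a)
                 *+ ((x \in G) && p^'.-elt x)].
Proof.
rewrite genGid; apply: intro_class_fun => [x y Gx Gy | x /negbTE-> //].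
rewrite groupJr // p_eltJ; congr (_ *+ _).
suff eqxy : char_poly (rG (x ^ y)%g) = char_poly (rG x).
  by rewrite /eigenvalues eqxy.
rewrite !repr_mxM ?groupM ?groupV // repr_mxV // mulmxA.
by rewrite char_poly_conj // repr_mx_unit.
Qed.

(* The Brauer character afforded by rG. A class function on the p-regular     *)
(* elements of G is encoded as a class function on G that vanishes on the     *)
(* other elements; 'Ind preserves this support condition, and restricts to    *)
(* the usual induction of Brauer characters.                                  *)
Definition cfBrauer (G : {group gT}) n (rG : mx_representation F G n) :
    'CF(G) :=
  Cfun 0 (cfBrauer_subproof rG).

Definition IBr (G : {group gT}) (phi : 'CF(G)) : Prop :=
  exists n : nat, exists2 rG : mx_representation F G n,
    mx_irreducible rG & phi = cfBrauer rG.

Definition monomial_Brauer (G : {group gT}) (phi : 'CF(G)) : Prop :=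
  exists H : {group gT}, H \subset G /\
    exists mu : 'CF(H), [/\ IBr mu, mu 1%g = 1 & phi = 'Ind[G] mu].

End BrauerCharacters.

(* Main.v *)
Require Import Defs.
From HB Require Import structures.
From mathcomp Require Import all_boot all_order all_algebra all_fingroup.
From mathcomp Require Import all_solvable all_field all_character.

Set Implicit Arguments.
Unset Strict Implicit.
Unset Printing Implicit Defensive.

Import GroupScope GRing.Theory.
Local Open Scope ring_scope.

(** If the Sylow [p]-subgroup [P] is normal, it acts trivially on every
    irreducible module in characteristic [p], so such a module is irreducible
    for the [p']-group [G / P].  Summing the conjugates of a matrix of trace 1
    by [G / P] gives, by Schur's lemma, a scalar [a] with [n * a = #|G / P|] in [F]; hence
    [p] does not divide the dimension [n] ([p'group_irr_degree]).

    For the converse, let [N <| G] be contained in [T <= G], and let [f] be a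
    linear character of [T] over [F] whose restriction to [N] is moved by every
    element of [G] outside [T].  The module induced from [f] is then irreducible
    ([indmx_irr], a case of the Clifford correspondence) and its Brauer character
    is induced from that of [f] ([cfBrauer_indmx]), so the hypothesis on [G] says
    that [p] never divides such an index [#|G : T|].  This property,
    [inertia_index_p'], passes to quotients, and it forces a normal Sylow
    subgroup ([normal_Sylow_of_inertia_index]).  Indeed let [N] be a minimal
    normal subgroup, which is elementary abelian.  By induction [N * P] is normal,
    so [G = N * 'N_G(P)] by the Frattini argument.  Unless [N] normalises [P], the
    order of [N] is prime to [p] and [N :&: 'N_G(P) = 1].  Every linear character
    of [N] then extends to its inertia group [T], because [T] splits over [N], and
    [T] contains [P] because [p] does not divide [#|G : T|].  Thus [P] fixes all
    linear characters of [N]; they separate points, so [P] centralises [N].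

    The formula for the induced Brauer character needs the eigenvalues of a
    monomial matrix over [F] whose nonzero entries are powers of a primitive root
    of unity [w] of order prime to [p].  Replacing [w] by an indeterminate lifts
    the matrix to [Z[X]], and substituting [theta w] gives a complex monomial
    matrix.  Integer polynomial relations satisfied by [theta w] are satisfied by
    [w], since the cyclotomic polynomial generates them; applied to the
    coefficients of characteristic polynomials this shows that [theta] matches the
    eigenvalues of the two matrices ([Brauer_sum_lift]).  The Brauer character is
    therefore the trace of the complex matrix, and this trace is the sum over
    the cosets of [T] that defines the induced class function. *)

(** * Roots of unity and specialisation of integer polynomials *)

Lemma closed_prim_root (F : closedFieldType) (m : nat) :
  (0 < m)%N -> (m%:R : F) != 0 -> {w : F | m.-primitive_root w}.
Proof.
move=> m_gt0 nz_m.
have [rs def_rs] := closed_field_poly_normal ('X^m - 1 : {poly F}).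
move: def_rs; rewrite (monicP (monic_Xn_sub_1 F m_gt0)) scale1r => def_rs.
have root_rs : all m.-unity_root rs.
  by apply/allP=> x; rewrite -root_prod_XsubC -def_rs.
have uniq_rs : uniq rs.
  by rewrite -separable_prod_XsubC -def_rs separable_Xn_sub_1.
have size_rs : (m <= size rs)%N.
  by rewrite -ltnS -(size_prod_XsubC rs id) -def_rs size_XnsubC.
have /hasP := has_prim_root m_gt0 root_rs uniq_rs size_rs.
by move=> /sig2_eqW [w _ prim_w]; exists w.
Qed.

(** Since ['X^m - 1] is the product of the ['Phi_d] for [d] dividing [m], some
    ['Phi_d] vanishes at [w]; then [w ^+ d = 1] forces [d = m].  This works in
    any characteristic. *)
Lemma Cyclotomic_root (R : idomainType) (m : nat) (w : R) :
  m.-primitive_root w -> root (map_poly intr 'Phi_m) w.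
Proof.
move=> prim_w; have m_gt0 := prim_order_gt0 prim_w.
have : root (map_poly intr (\prod_(d <- divisors m) 'Phi_d)) w.
  rewrite prod_Cyclotomic // rmorphB rmorph1 /= map_polyXn.
  by rewrite rootE !hornerE prim_expr_order // subrr.
rewrite rmorph_prod /= rootE horner_prod prodf_seq_eq0.
case/hasP=> d; rewrite -dvdn_divisors //= => d_dv_m root_d.
have d_gt0 := dvdn_gt0 m_gt0 d_dv_m.
suff : w ^+ d == 1.
  rewrite -(prim_order_dvd prim_w) => m_dv_d.
  by have /eqP <- : d == m; rewrite // eqn_dvd d_dv_m.
have : root (map_poly intr ('X^d - 1 : {poly int})) w.
  rewrite -prod_Cyclotomic // (bigD1_seq d) ?divisors_uniq -?dvdn_divisors //=.
  by rewrite rmorphM rootM rootE root_d.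
by rewrite rmorphB rmorph1 /= map_polyXn rootE !hornerE subr_eq0.
Qed.

Definition specialize (R : comNzRingType) (w : R) :
    {rmorphism {poly int} -> R} :=
  horner_eval w \o map_poly intr.

(** The integer polynomials that vanish at a primitive [m]-th root of unity of
    [algC] are the multiples of ['Phi_m], and these vanish at any primitive
    [m]-th root of unity [w].  In other words [z |-> w] defines a ring morphism
    from [Z[z]] to [R]. *)
Lemma specialize_eq0 (R : idomainType) (m : nat) (w : R) (z : algC)
    (q : {poly int}) :
    m.-primitive_root w -> m.-primitive_root z ->
  specialize z q = 0 -> specialize w q = 0.
Proof.
rewrite /= /horner_eval => prim_w prim_z qz0.
have mon := Cyclotomic_monic m.
have def_q := Pdiv.RingMonic.rdivp_eq mon q.
set r := Pdiv.Ring.rmodp q _ in def_q.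
have lt_r : (size r < size 'Phi_m)%N.
  by rewrite Pdiv.Ring.ltn_rmodp monic_neq0.
suff r0 : r = 0.
  rewrite def_q r0 addr0 rmorphM /= hornerM.
  by rewrite (eqP (Cyclotomic_root prim_w)) mulr0.
(* The minimal polynomial Q of z over the rationals has the size of 'Phi_m, *)
(* so it cannot divide the shorter remainder r unless r = 0.                *)
have [Q [def_Q mon_Q] dv_Q] := minCpolyP z.
have def_intr (u : {poly int}) :
    map_poly (ratr : rat -> algC) (map_poly intr u) = map_poly intr u.
  by rewrite -map_poly_comp; apply: eq_map_poly => a /=; rewrite ratr_int.
have : root (map_poly (ratr : rat -> algC) (map_poly intr r)) z.
  move: qz0; rewrite def_q rmorphD rmorphM /= hornerD hornerM.
  by rewrite (eqP (Cyclotomic_root prim_z)) mulr0 add0r def_intr => /eqP.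
rewrite dv_Q => Q_dv_r.
have size_Q : size Q = size 'Phi_m.
  rewrite -(size_map_poly (ratr : {rmorphism rat -> algC}) Q) -def_Q.
  rewrite (minCpoly_cyclotomic prim_z) -(Cintr_Cyclotomic prim_z).
  exact/size_map_inj_poly/rmorph0/intr_inj.
have size_r : size (map_poly intr r : {poly rat}) = size r.
  exact/size_map_inj_poly/rmorph0/intr_inj.
apply/eqP; apply: contraLR lt_r => nz_r; rewrite -leqNgt -size_Q -size_r.
by apply: dvdp_leq Q_dv_r; rewrite -size_poly_eq0 size_r size_poly_eq0.
Qed.

Section BrauerLift.

Variables (F : closedFieldType) (theta : F -> algC).
Hypothesis thetaP : brauer_lift theta.

Lemma prim_expr_unity m (w : F) k :
  m.-primitive_root w -> w ^+ k \in m.-unity_root.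
Proof.
move=> prim_w; rewrite -topredE /= unity_rootE exprAC.
by rewrite (prim_expr_order prim_w) expr1n.
Qed.

Lemma brauer_liftX m (w : F) k :
  m.-primitive_root w -> theta (w ^+ k) = theta w ^+ k.
Proof.
have [theta1 thetaM] := thetaP; move=> prim_w.
have [{}thetaM _] := thetaM m (prim_order_gt0 prim_w).
elim: k => [|k IHk]; first by rewrite !expr0.
by rewrite !exprS thetaM ?IHk // ?prim_expr_unity // -[w]expr1 prim_expr_unity.
Qed.

Lemma brauer_lift_prim_root m (w : F) :
  m.-primitive_root w -> m.-primitive_root (theta w).
Proof.
move=> prim_w; have m_gt0 := prim_order_gt0 prim_w.
rewrite /primitive_root_of_unity m_gt0 /=; apply/forallP=> i.
have/andP[_ /forallP/(_ i)/eqP <-] := prim_w.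
have [theta1 /(_ m m_gt0)[_ inj_theta]] := thetaP.
rewrite !unity_rootE -(brauer_liftX _ prim_w).
apply/eqP; apply/eqP/eqP=> [thetaX1 | ->]; last exact: theta1.
apply: inj_theta; rewrite ?theta1 //; first exact: prim_expr_unity.
by rewrite -(expr0 w) prim_expr_unity.
Qed.

End BrauerLift.

Lemma sum_eigenvalues (F : closedFieldType) n (A : 'M[F]_n) :
  \sum_(a <- eigenvalues A) a = \tr A.
Proof.
case: n A => [|n] A.
  rewrite /mxtrace big_ord0; have := eigenvaluesP A; move: (eigenvalues A) => s.
  move/(congr1 (size \o polyseq)); rewrite /= size_char_poly.
  by rewrite size_prod_XsubC; case: s => // _; rewrite big_nil.
have size_s : size (eigenvalues A) = n.+1.
  apply: succn_inj; rewrite -(size_prod_XsubC _ id) -eigenvaluesP.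
  by rewrite size_char_poly.
apply: oppr_inj; rewrite -char_poly_trace // eigenvaluesP.
by rewrite -coefPn_prod_XsubC size_s.
Qed.

(** If the eigenvalues of the complex specialisation are the [theta w ^+ k] for [k]
    in some list, then the factorisation of its characteristic polynomial is an
    integer relation satisfied by [theta w], hence by [w]: the eigenvalues of the
    specialisation at [w] are the [w ^+ k] for the same exponents. *)
Lemma Brauer_sum_lift (F : closedFieldType) (theta : F -> algC) m (w : F) n
    (A : 'M[{poly int}]_n) :
  brauer_lift theta -> m.-primitive_root w ->
  all m.-unity_root
    (eigenvalues (map_mx (specialize (theta w)) A)) ->
  \sum_(a <- eigenvalues (map_mx (specialize w) A)) theta a =
    \tr (map_mx (specialize (theta w)) A).
Proof.
move=> thetaP prim_w; have prim_z := brauer_lift_prim_root thetaP prim_w.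
set z := theta w in prim_z *.
set Aw := map_mx (specialize w) A; set Az := map_mx (specialize z) A.
move=> unity_z; rewrite -sum_eigenvalues.
have [ks def_ks] : exists ks : seq nat, eigenvalues Az = [seq z ^+ k | k <- ks].
  elim: (eigenvalues Az) unity_z => [|a s IHs] /=; first by exists [::].
  case/andP=> /unity_rootP a1 /IHs[ks ->].
  by have [k ->] := prim_rootP prim_z a1; exists (val k :: ks).
have charAw : char_poly Aw = \prod_(a <- [seq w ^+ k | k <- ks]) ('X - a%:P).
  apply/eqP; rewrite -subr_eq0.
  (* D is a relation over Z[X] that vanishes at theta w by the choice of ks. *)
  pose D := char_poly A - \prod_(k <- ks) ('X - ('X^k)%:P).
  have spec (R : comNzRingType) (u : R) : map_poly (specialize u) D =
      char_poly (map_mx (specialize u) A) -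
      \prod_(a <- [seq u ^+ k | k <- ks]) ('X - a%:P).
    rewrite /D rmorphB rmorph_prod /= map_char_poly big_map; congr (_ - _).
    apply: eq_bigr => k _; rewrite rmorphB /= map_polyX map_polyC /=.
    by rewrite /horner_eval map_polyXn hornerXn.
  rewrite -spec; apply/eqP/polyP=> i; rewrite coef_map coef0.
  apply: (specialize_eq0 prim_w prim_z).
  have/polyP/(_ i) : map_poly (specialize z) D = 0.
    by rewrite spec -/Az eigenvaluesP def_ks subrr.
  by rewrite coef_map coef0.
rewrite def_ks big_map.
have perm_w : perm_eq (eigenvalues Aw) [seq w ^+ k | k <- ks].
  by apply: prod_XsubC_eq; rewrite -eigenvaluesP.
rewrite (perm_big _ perm_w) big_map; apply: eq_bigr => k _.
by rewrite (brauer_liftX thetaP _ prim_w).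
Qed.

(** * The monomial representation induced from a linear character *)

Section InducedMatrix.

Variables (gT : finGroupType) (G T : {group gT}).
Hypothesis sTG : T \subset G.

(** Representatives of the right cosets of [T] in [G], which index the basis of
    the induced module. *)
Definition transv (i : 'I_#|G : T|) : gT := repr (enum_val i).

Lemma transvE i : enum_val i = T :* transv i.
Proof.
have /rcosetsP[x _ def_i] := enum_valP i.
by rewrite /transv def_i; apply/esym/rcoset_eqP/mem_repr_rcoset.
Qed.

Lemma transv_in i : transv i \in G.
Proof.
have /rcosetsP[x Gx def_i] := enum_valP i.
rewrite /transv def_i; have := mem_repr_rcoset T x.
by apply/subsetP; rewrite mul_subG ?sub1set.
Qed.

Lemma transv_exists x : x \in G -> exists j, (x * (transv j)^-1)%g \in T.
Proof.
move=> Gx; have TGx : T :* x \in rcosets T G by apply/rcosetsP; exists x.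
exists (enum_rank_in TGx (T :* x)); rewrite -mem_rcoset -transvE.
by rewrite enum_rankK_in ?rcoset_refl.
Qed.

Lemma transv_eq i j : (transv i * (transv j)^-1)%g \in T -> i = j.
Proof.
rewrite -mem_rcoset => /rcoset_eqP eq_ij.
by apply: enum_val_inj; rewrite !transvE.
Qed.

Lemma sum_transv (R : nzRingType) (h : gT -> R) :
    {in T & G, forall t y, h (t * y)%g = h y} ->
  \sum_(y in G) h y = #|T|%:R * \sum_i h (transv i).
Proof.
move=> hT; rewrite (set_partition_big _ (rcosets_partition sTG)) big_enum_val.
rewrite mulr_sumr; apply: eq_bigr => i _; rewrite /= transvE.
rewrite -(card_rcoset _ (transv i)) mulr_natl -sumr_const.
apply: eq_bigr => y /rcosetP[t Tt ->]; exact/hT/transv_in.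
Qed.

(** The action on row vectors of the module induced from a linear character [f]
    of [T].  It makes sense for any function [f] over any ring, so that it can be
    applied to lifts of [f] that are not multiplicative. *)
Definition indmx (R : nzRingType) (f : gT -> R) x : 'M[R]_#|G : T| :=
  \matrix_(i, j) let t := (transv i * x * (transv j)^-1)%g in
                 if t \in T then f t else 0.

Section Representation.

Variables (R : comUnitRingType) (f : gT -> R).
Hypotheses (f1 : f 1%g = 1)
  (fM : {in T &, {morph f : x y / (x * y)%g >-> x * y}}).

Lemma indmx_repr : mx_repr G (indmx f).
Proof.
split=> [|x y Gx Gy]; apply/matrixP=> i k; rewrite !mxE /=.
  rewrite mulg1; have [<-|/eqP neq_ik] := altP (i =P k).
    by rewrite mulgV group1 f1.
  by case: ifP => // /transv_eq.
(* Only the coset T r_j that contains r_i x contributes to the (i, k) entry *)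
(* of the product.                                                          *)
have [|j Tj] := transv_exists (x := (transv i * x)%g).
  by rewrite groupM ?transv_in.
rewrite (bigD1 j) //= big1 ?addr0 => [|l neq_lj]; rewrite !mxE /=.
  have -> : (transv i * (x * y) * (transv k)^-1 =
      (transv i * x * (transv j)^-1) * (transv j * y * (transv k)^-1))%g.
    by rewrite !mulgA mulgKV.
  rewrite Tj groupMl //; case: ifP => Tk; last by rewrite mulr0.
  by rewrite fM.
case: ifP => [Tl|_]; last by rewrite mul0r.
case/eqP: neq_lj; apply: transv_eq; move: (transv i * x)%g Tl Tj => a Tl Tj.
by have:= groupM (groupVr Tl) Tj; rewrite invMg invgK !mulgA mulgKV.
Qed.

Canonical indmx_representation := MxRepresentation indmx_repr.

End Representation.

Lemma map_indmx (R S : nzRingType) (u : {rmorphism R -> S}) (f : gT -> R)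
    (h : gT -> S) x :
  {in T, u \o f =1 h} -> map_mx u (indmx f x) = indmx h x.
Proof.
move=> fh; apply/matrixP=> i j; rewrite !mxE /=.
by case: ifP => [/fh <- //|_]; rewrite rmorph0.
Qed.

End InducedMatrix.

(** The basis vectors of the induced module are eigenvectors of [N], for linear
    characters that are the [G]-conjugates of the restriction of [f]; they are
    pairwise distinct because [T] contains the inertia group of that restriction.
    Hence a nonzero submodule contains a basis vector, and so all of them as [G]
    permutes the basis lines transitively. *)
Lemma indmx_irr (F : fieldType) (gT : finGroupType) (G T N : {group gT})
    (sTG : T \subset G) (f : gT -> F) (f1 : f 1%g = 1)
    (fM : {in T &, {morph f : x y / (x * y)%g >-> x * y}}) :
    N <| G -> N \subset T ->
    {in G :\: T, forall g, exists2 n, n \in N & f (n ^ g)%g != f n} ->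
  mx_irreducible (indmx_representation sTG f1 fM).
Proof.
move=> /andP[sNG nNG] sNT sepN; set rG := indmx_representation sTG f1 fM.
have NJ n (i : 'I_#|G : T|) : n \in N -> (transv i * n * (transv i)^-1)%g \in N.
  have nNi := subsetP nNG _ (transv_in sTG i).
  by rewrite -mulgA -{1}[transv i]invgK -conjgE memJ_norm ?groupV.
have TJ n (i : 'I_#|G : T|) : n \in N -> (transv i * n * (transv i)^-1)%g \in T.
  by move/(NJ n i); apply/subsetP.
have actN u n l : n \in N ->
    (u *m rG n) 0 l = u 0 l * f (transv l * n * (transv l)^-1)%g.
  move=> Nn; rewrite mxE (bigD1 l) //= !mxE /= TJ //.
  rewrite big1 ?addr0 // => i neq_il; rewrite !mxE /=.
  case: ifP => [|_]; last by rewrite mulr0.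
  have -> : (transv i * n * (transv l)^-1 =
      (transv i * n * (transv i)^-1) * (transv i * (transv l)^-1))%g.
    by rewrite !mulgA mulgKV.
  rewrite groupMl ?TJ // => /transv_eq eq_il.
  by rewrite eq_il eqxx in neq_il.
apply/mx_irrP; split=> [|U Umod nzU]; first exact: indexg_gt0.
have Ustab u x : (u <= U)%MS -> x \in G -> (u *m rG x <= U)%MS.
  by move=> Uu Gx; apply: mxmodule_trans Umod Gx Uu.
have sep (i j : 'I_#|G : T|) : j != i -> exists2 n, n \in N &
    f (transv j * n * (transv j)^-1)%g != f (transv i * n * (transv i)^-1)%g.
  move=> neq_ji; have [|n Nn sep_n] := sepN (transv i * (transv j)^-1)%g.
    rewrite inE; apply/andP.
    split; last by rewrite groupM ?groupV ?(transv_in sTG).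
    by apply: contra neq_ji => /transv_eq->.
  exists (n ^ transv i)%g.
    by rewrite memJ_norm // (subsetP nNG) ?(transv_in sTG).
  by move: sep_n; rewrite !conjgE !invMg !invgK !mulgA !mulgV !mul1g mulgK.
(* Take a nonzero vector u of U with coordinates i and j in its support: for *)
(* n in N separating the characters of i and j, u * n - f(n^(r_i^-1)) u has  *)
(* smaller support, and its j-th coordinate is nonzero.                      *)
have [i Ui] : exists i, (delta_mx (0 : 'I_1) i <= U)%MS.
  have Uu := nz_row_sub U; move: nzU; rewrite -nz_row_eq0.
  move: (nz_row U) Uu => u; have [k] := ubnP #|[set i | u 0 i != 0]|.
  elim: k u => // k IHk u le_k Uu nzu.
  have /rV0Pn[i ui] := nzu.
  have [/existsP[j /andP[neq_ji uj]] | /existsPn only_i] :=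
    boolP [exists j, (j != i) && (u 0 j != 0)].
    have [n Nn sep_n] := sep i j neq_ji.
    pose v := u *m rG n - f (transv i * n * (transv i)^-1)%g *: u.
    have vE l : v 0 l = u 0 l * (f (transv l * n * (transv l)^-1)%g -
                                 f (transv i * n * (transv i)^-1)%g).
      rewrite mxE actN // !mxE mulrBr.
      by rewrite [in RHS](mulrC (u 0 l) (f (transv i * _ * _)%g)).
    apply: (IHk v).
    - apply: leq_trans (proper_card _) le_k; apply/properP; split.
        by apply/subsetP=> l; rewrite !inE vE mulf_eq0 negb_or => /andP[].
      by exists i; rewrite !inE ?vE ?subrr ?mulr0 ?eqxx.
    - by rewrite addmx_sub ?eqmx_opp ?scalemx_sub ?Ustab // (subsetP sNG).
    - by apply/rV0Pn; exists j; rewrite vE mulf_neq0 // subr_eq0.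
  exists i; suff <- : (u 0 i)^-1 *: u = delta_mx 0 i by apply: scalemx_sub.
  apply/rowP=> j; rewrite !mxE /=; have [-> | neq_ji] := eqVneq j i.
    by rewrite mulVf.
  by move: (only_i j); rewrite neq_ji /= negbK => /eqP->; rewrite mulr0.
rewrite -sub1mx; apply/row_subP=> j; rewrite row1.
suff <- : row i (rG ((transv i)^-1 * transv j)%g) = delta_mx 0 j.
  by rewrite rowE Ustab // groupM ?groupV ?(transv_in sTG).
apply/rowP=> k; rewrite !mxE /= mulKVg.
have [-> | neq_kj] := eqVneq k j; first by rewrite mulgV group1.
by case: ifP => // /transv_eq eq_jk; rewrite eq_jk eqxx in neq_kj.
Qed.

(** * The Brauer character of the induced representation *)

Section LinearRepresentation.

Variables (R : comUnitRingType) (gT : finGroupType) (T : {group gT}).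
Variable f : gT -> R.
Hypotheses (f1 : f 1%g = 1)
  (fM : {in T &, {morph f : x y / (x * y)%g >-> x * y}}).

Lemma linmx_repr : mx_repr T (fun x => (f x)%:M : 'M_1).
Proof. by split=> [|x y Tx Ty]; rewrite ?f1 // fM // scalar_mxM. Qed.

Canonical linmx_representation := MxRepresentation linmx_repr.

Lemma linX x k : x \in T -> f (x ^+ k)%g = f x ^+ k.
Proof.
move=> Tx; elim: k => [|k IHk]; first by rewrite expg0 expr0.
by rewrite expgS exprS fM ?groupX // IHk.
Qed.

End LinearRepresentation.

(** In characteristic [p], [y ^+ q = 1] implies [y = 1] when [q] is a power of
    [p], since [(y - 1) ^+ q = y ^+ q - 1]. *)
Lemma lin_unity_root (F : fieldType) (p : nat) (gT : finGroupType)
    (G : {group gT}) (f : gT -> F) x :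
    p \in [pchar F] -> f 1%g = 1 ->
    {in G &, {morph f : x y / (x * y)%g >-> x * y}} ->
  x \in G -> (#|G|`_p^')%N.-unity_root (f x).
Proof.
move=> charF f1 fM Gx; set m := (#|G|`_p^')%N.
have charFq : [pchar F].-nat (#|G|`_p)%N.
  by rewrite (eq_pnat _ (pcharf_eq charF)) part_pnat.
suff: (f x ^+ m - 1) ^+ (#|G|`_p)%N == 0.
  by rewrite expf_eq0 subr_eq0 => /andP[_]; rewrite unity_rootE.
rewrite exprDn_pchar // exprNn_pchar // expr1n -exprM mulnC partnC ?cardG_gt0 //.
by rewrite -(linX f1 fM) // expg_cardG // f1 subrr.
Qed.

Lemma eigenvalues_dim1 (F : closedFieldType) (a : F) :
  eigenvalues (a%:M : 'M_1) = [:: a].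
Proof.
have := sum_eigenvalues (a%:M : 'M_1); rewrite mxtrace_scalar.
have := size_char_poly (a%:M : 'M[F]_1); rewrite eigenvaluesP size_prod_XsubC.
by case: (eigenvalues _) => [|b [|//]] //= _; rewrite big_seq1 => ->.
Qed.

Lemma repr_unity_root (F : fieldType) (gT : finGroupType) (G : {group gT}) n
    (rG : mx_representation F G n) x a :
  x \in G -> root (char_poly (rG x)) a -> a ^+ #[x]%g = 1.
Proof.
move=> Gx; rewrite -eigenvalue_root_char => /eigenvalueP[v va nz_v].
have vaX k : v *m rG (x ^+ k)%g = a ^+ k *: v.
  elim: k => [|k IHk]; first by rewrite repr_mx1 mulmx1 scale1r.
  by rewrite expgSr exprSr repr_mxM ?groupX // mulmxA IHk -scalemxAl va scalerA.
have := vaX #[x]%g; rewrite expg_order repr_mx1 mulmx1 => /esym/eqP.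
rewrite -subr_eq0 -{2}[v]scale1r -scalerBl scaler_eq0 (negPf nz_v) orbF subr_eq0.
by move/eqP.
Qed.

(** All values of [f] are powers of a root of unity [w] of order [#|G|`_p^'], so
    the induced matrix lifts to [Z[X]] by choosing exponents.  Its specialisation
    at [theta w] belongs to the complex representation induced from [theta \o f],
    so its eigenvalues at a [p]-regular element have order prime to [p]. *)
Lemma Brauer_trace_indmx (F : closedFieldType) (theta : F -> algC) (p : nat)
    (gT : finGroupType) (G T : {group gT}) (f : gT -> F) x :
    brauer_lift theta -> p \in [pchar F] -> T \subset G -> f 1%g = 1 ->
    {in T &, {morph f : x y / (x * y)%g >-> x * y}} ->
    x \in G -> p^'.-elt x ->
  \sum_(a <- eigenvalues (indmx G T f x)) theta a =
    \tr (indmx G T (theta \o f) x).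
Proof.
move=> thetaP charF sTG f1 fM Gx p'x; set m := (#|G|`_p^')%N.
have m_gt0 : (0 < m)%N := part_gt0 _ _.
have [w prim_w] : {w : F | m.-primitive_root w}.
  apply: closed_prim_root => //; rewrite -(dvdn_pcharf charF).
  by rewrite -p'natE ?(pcharf_prime charF) ?part_pnat.
have f_unity t : t \in T -> m.-unity_root (f t).
  move=> Tt; have := lin_unity_root charF f1 fM Tt; rewrite !unity_rootE.
  have /dvdnP[k ->] : (#|T|`_p^' %| m)%N by rewrite partn_dvd ?cardSg.
  by rewrite mulnC exprM => /eqP->; rewrite expr1n.
pose k t := if [pick i : 'I_m | f t == w ^+ i] is Some i then val i else 0%N.
have fE t : t \in T -> f t = w ^+ k t.
  move=> /f_unity/unity_rootP/(prim_rootP prim_w)[i def_ft].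
  by rewrite /k; case: pickP => [j /eqP // | /(_ i)/eqP].
have specE (R : comNzRingType) (u : R) j : specialize u 'X^j = u ^+ j.
  by rewrite /= /horner_eval map_polyXn hornerXn.
pose A := indmx G T (fun t => 'X^(k t) : {poly int}) x.
have <- : map_mx (specialize w) A = indmx G T f x.
  by apply: map_indmx => t Tt; rewrite fE // -specE.
have Az : map_mx (specialize (theta w)) A = indmx G T (theta \o f) x.
  apply: map_indmx => t Tt /=; rewrite fE // (brauer_liftX thetaP _ prim_w).
  exact: specE.
have := Brauer_sum_lift (A := A) thetaP prim_w.
rewrite [map_mx (specialize (theta w)) A]Az; apply.
have [theta1 /(_ m m_gt0)[thetaM _]] := thetaP.
have g1 : (theta \o f) 1%g = 1 by rewrite /= f1.
have gM : {in T &, {morph theta \o f : y z / (y * z)%g >-> y * z}}.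
  by move=> y z Ty Tz; rewrite /= fM // thetaM // -topredE; apply: f_unity.
apply/allP=> a; rewrite -root_prod_XsubC -eigenvaluesP.
move/(repr_unity_root (rG := indmx_representation sTG g1 gM) Gx) => aX.
rewrite unity_rootE; have /dvdnP[c ->] : (#[x]%g %| m)%N.
  by rewrite -(part_pnat_id p'x) partn_dvd ?order_dvdG.
by rewrite mulnC exprM aX expr1n.
Qed.

Lemma cfBrauer_indmx (F : closedFieldType) (theta : F -> algC) (p : nat)
    (gT : finGroupType) (G T : {group gT}) (sTG : T \subset G) (f : gT -> F)
    (f1 : f 1%g = 1) (fM : {in T &, {morph f : x y / (x * y)%g >-> x * y}}) :
    brauer_lift theta -> p \in [pchar F] ->
  cfBrauer p theta (indmx_representation sTG f1 fM) =
    'Ind[G] (cfBrauer p theta (linmx_representation f1 fM)).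
Proof.
move=> thetaP charF; apply/cfunP=> x.
have [Gx | notGx] := boolP (x \in G); last by rewrite !cfun0.
rewrite cfIndE // cfunE Gx /=.
have [p'x | not_p'x] := boolP (p^'.-elt x); last first.
  rewrite mulr0n big1 ?mulr0 // => y Gy.
  by rewrite cfunE p_eltJ (negPf not_p'x) andbF.
rewrite (Brauer_trace_indmx thetaP charF) // (reindex_inj invg_inj) /=.
rewrite (eq_bigl (mem G)) => [|y]; last by rewrite inE groupV.
rewrite (sum_transv sTG) => [|t y Tt Gy]; last first.
  by rewrite /= invMg conjgM; apply: cfunJ; rewrite groupV.
rewrite mulrA mulVf ?neq0CG // mul1r mulr1n.
apply: eq_bigr => i _; rewrite mxE cfunE p_eltJ p'x andbT.
rewrite conjgE invgK mulgA /=; case: (_ \in T) => //.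
by rewrite eigenvalues_dim1 big_seq1.
Qed.

(** * Recognising a normal Sylow subgroup *)

(** The subgroup [T] is the inertia group of the restriction of [f] to [N]: it
    stabilises this restriction because [f] is a class function on [T], and the
    last hypothesis says that no other element does. *)
Definition inertia_index_p' (F : fieldType) (p : nat) (gT : finGroupType)
    (G : {group gT}) : Prop :=
  forall (N T : {group gT}) (f : gT -> F),
    N <| G -> N \subset T -> T \subset G -> f 1%g = 1 ->
    {in T &, {morph f : x y / (x * y)%g >-> x * y}} ->
    {in G :\: T, forall g, exists2 n, n \in N & f (n ^ g)%g != f n} ->
  ~~ (p %| #|G : T|)%N.

Lemma inertia_index_p'_quotient (F : fieldType) (p : nat)
    (gT : finGroupType) (G L : {group gT}) :
  L <| G -> inertia_index_p' F p G -> inertia_index_p' F p (G / L).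
Proof.
move=> nsLG goodG N T f nsN sNT sTG f1 fM sep; have [sLG nLG] := andP nsLG.
rewrite -index_cosetpre quotientGK //.
have sTG' : coset L @*^-1 T \subset G by rewrite -(quotientGK nsLG) morphpreS.
have nL x : x \in coset L @*^-1 T -> x \in 'N(L).
  by move/(subsetP sTG'); apply/subsetP.
apply: (goodG (coset L @*^-1 N)%G _ (f \o coset L)) => //=.
- by rewrite -(quotientGK nsLG) cosetpre_normal.
- exact: morphpreS.
- by rewrite coset_id ?group1.
- move=> x y Tx Ty; rewrite /= morphM ?nL // fM //.
    by case/morphpreP: Tx.
  by case/morphpreP: Ty.
- move=> g /setDP[Gg notTg]; have nLg := subsetP nLG g Gg.
  have [|n Nn sep_n] := sep (coset L g).
    rewrite inE mem_quotient // andbT.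
    by apply: contra notTg => Tg; apply/morphpreP.
  have [n' nLn' def_n] := cosetP n.
  exists n'; first by apply/morphpreP; split; rewrite //= -def_n.
  by rewrite /= morphJ //= -def_n.
Qed.

(** View [E] as a vector space over ['F_q], and compose a coordinate on which [c]
    is nonzero with [i |-> w ^+ i]. *)
Lemma abelem_lin_separate (F : fieldType) (q : nat) (w : F)
    (gT : finGroupType) (E : {group gT}) c :
    prime q -> q.-primitive_root w -> q.-abelem E -> c \in E -> c != 1%g ->
  exists f : gT -> F, [/\ f 1%g = 1,
    {in E &, {morph f : x y / (x * y)%g >-> x * y}} & f c != 1].
Proof.
move=> q_pr prim_w abelE Ec nt_c.
have ntE : E :!=: 1%g by apply: contraNneq nt_c => E1; rewrite E1 inE in Ec.
have /rV0Pn[j cj] : abelem_rV abelE ntE c != 0.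
  apply: contraNneq nt_c => c0; apply/eqP.
  apply: (@abelem_rV_inj q _ E abelE ntE) => //.
  by rewrite c0 abelem_rV_1.
(* Addition in 'F_q reduces modulo this unfolded form of q. *)
rewrite -(Fp_cast q_pr) in prim_w.
exists (fun x => w ^+ abelem_rV abelE ntE x 0 j); split.
- by rewrite abelem_rV_1 mxE.
- move=> x y Ex Ey; rewrite abelem_rV_M // mxE -exprD /=.
  exact: prim_expr_mod.
- rewrite -(prim_order_dvd prim_w) gtnNdvd ?ltn_ord //.
  by rewrite lt0n; apply: contra cj => /eqP c0; apply/eqP/val_inj.
Qed.

(** Induction on [#|G|] through a minimal normal subgroup [N] of [G].  By the
    Frattini argument it is enough that [N] normalises a Sylow subgroup [P].
    Otherwise ['N_G(P)] is a complement to [N] in [G], and the hypothesis applied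
    to the linear characters of [N], extended to their inertia groups, shows that
    [P] centralises [N]. *)
Lemma normal_Sylow_of_inertia_index (F : closedFieldType) (p : nat)
    (gT : finGroupType) (G : {group gT}) :
    p \in [pchar F] -> solvable G -> inertia_index_p' F p G ->
  p.-Sylow(G) 'O_p(G).
Proof.
move=> charF; have p_pr := pcharf_prime charF.
have [n] := ubnP #|G|; elim: n gT G => // n IHn gT G /ltnSE-le_n solG goodG.
have [G1 | ntG] := eqVneq (G : {set gT}) 1%g.
  have pG : p.-group G by rewrite G1 pgroup1.
  by rewrite pcore_pgroup_id // pHallE subxx part_pnat_id /=.
have [N minN sNG] := minnormal_exists ntG (normG G).
have [nNG ntN /is_abelemP[q q_pr abelN]] := minnormal_solvable minN sNG solG.
have nsNG : N <| G by apply/andP.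
have [P sylP] := Sylow_exists p G; have sPG := pHall_sub sylP.
suff nPG : G \subset 'N(P).
  have nsPG : P <| G by apply/andP.
  by rewrite (normal_Hall_pcore sylP nsPG).
have nsNPG : N <*> P <| G.
  have sylPN := quotient_pHall (subset_trans sPG nNG) sylP.
  have hallO : p.-Sylow(G / N) 'O_p(G / N).
    apply: IHn; rewrite ?quotient_sol //; last exact: inertia_index_p'_quotient.
    by apply: leq_trans le_n; rewrite ltn_quotient.
  have nsPN : P / N <| G / N.
    by rewrite (eq_Hall_pcore hallO sylPN) pcore_normal.
  have nNP := subset_trans sPG nNG.
  by rewrite -(quotientYK nNP) -(quotientGK nsNG) cosetpre_normal.
have defG : (N * 'N_G(P))%g = G.
  have sylPL : p.-Sylow(N <*> P) P.
    by apply: pHall_subl sylP; rewrite ?joing_subr ?normal_sub.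
  have := Frattini_arg nsNPG sylPL; rewrite /= norm_joinEr ?(subset_trans sPG) //.
  by rewrite -mulgA mulSGid // subsetI sPG normG.
suff nPN : N \subset 'N(P) by rewrite -defG mul_subG // subsetIr.
have [eq_qp | neq_qp] := eqVneq q p.
  rewrite (subset_trans _ (normG P)) //.
  apply: subset_trans (pcore_sub_Hall sylP).
  by rewrite pcore_max // -eq_qp abelem_pgroup.
have cNN := abelem_abelian abelN.
have /mingroupP[_ min_N] := minN.
(* N :&: 'N_G(P) is normalised by 'N_G(P), and by N as N is abelian. *)
have nsNC : G \subset 'N(N :&: 'N_G(P)).
  rewrite -{1}defG mul_subG //; last first.
    by rewrite normsI ?normG // subIset // nNG.
  by rewrite (sub_abelian_norm cNN) ?subsetIl.
have [tiNC | ntNC] := eqVneq (N :&: 'N_G(P)) 1%g; last first.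
  have <- : N :&: 'N_G(P) = N by apply: min_N; rewrite ?ntNC ?subsetIl.
  by rewrite setIA subsetIr.
apply: subset_trans (cent_sub P); rewrite centsC; apply/centsP=> x Px a Na.
apply/commgP; apply: contraT => nt_xa.
have Gx : x \in G by apply: (subsetP sPG).
have NJ b y : b \in N -> y \in G -> (b ^ y)%g \in N.
  by move=> Nb Gy; rewrite memJ_norm // (subsetP nNG).
have [w prim_w] : {w : F | q.-primitive_root w}.
  apply: closed_prim_root; first exact: prime_gt0.
  by rewrite -(dvdn_pcharf charF) dvdn_prime2 // eq_sym.
have Nxa : [~ a, x]%g \in N by rewrite groupM ?groupV ?NJ.
rewrite -invg_comm eq_invg1 in nt_xa.
have [lam [lam1 lamM]] := abelem_lin_separate q_pr prim_w abelN Nxa nt_xa.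
(* A is the inertia group of lam. *)
pose A := [set y in G | [forall b in N, lam (b ^ y)%g == lam b]].
have AE y b : y \in A -> b \in N -> lam (b ^ y)%g = lam b.
  by rewrite inE => /andP[_ /forall_inP lamJ] /lamJ/eqP.
have gA : group_set A.
  apply/group_setP; split=> [|y z Ay Az].
    by rewrite inE group1; apply/forall_inP=> b _; rewrite conjg1.
  have [Gy Gz] : y \in G /\ z \in G.
    by move: Ay Az; rewrite !inE => /andP[-> _] /andP[].
  rewrite inE groupM //; apply/forall_inP=> b Nb.
  by rewrite conjgM AE ?NJ // AE.
pose T := Group gA.
have sTG : T \subset G by apply/subsetP=> y; rewrite inE => /andP[].
have sNT : N \subset T.
  apply/subsetP=> y Ny; rewrite inE (subsetP sNG) //=.
  by apply/forall_inP=> b Nb; rewrite conjgE (centsP cNN _ Nb _ Ny) mulKg.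
(* As T splits over N, lam extends to T by ignoring the factor in 'N_G(P). *)
pose f y := lam (divgr N 'N_G(P) y).
have fN b : b \in N -> f b = lam b by move=> Nb; rewrite /f divgr_id.
have fM : {in T &, {morph f : y z / (y * z)%g >-> y * z}}.
  move=> y z Ty Tz; rewrite /f.
  have NCT u : u \in T -> u \in (N * 'N_G(P))%g.
    by rewrite defG; apply: (subsetP sTG).
  have /mulsgP[b c Nb Cc def_y] := NCT y Ty.
  have /mulsgP[b' c' Nb' Cc' def_z] := NCT z Tz.
  have Tc : c \in T.
    by rewrite -(mulKg b c) -def_y groupM // groupV (subsetP sNT).
  have -> : (y * z = (b * b' ^ c^-1) * (c * c'))%g.
    by rewrite def_y def_z conjgE invgK !mulgA mulgKV.
  have Gc : c \in G by apply: (subsetP sTG).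
  have Nbc : (b' ^ c^-1)%g \in N by rewrite NJ ?groupV.
  have [NbbC CCc] := (groupM Nb Nbc, groupM Cc Cc').
  by rewrite def_y def_z !divgrMid // lamM // (AE _ _ (groupVr Tc)).
have sep : {in G :\: T, forall g, exists2 b, b \in N & f (b ^ g)%g != f b}.
  move=> g /setDP[Gg]; rewrite inE Gg /= => /forall_inPn[b Nb sep_b].
  by exists b; rewrite ?fN ?NJ.
have p'T := goodG N T f nsNG sNT sTG (etrans (fN _ (group1 N)) lam1) fM sep.
(* T contains a Sylow subgroup P :^ (c * b) = P :^ b with c in 'N_G(P) and b *)
(* in N; as N is contained in T, so is P.                                    *)
have Tx : x \in T.
  have [Q sylQ] := Sylow_exists p T.
  have sylQG : p.-Sylow(G) Q.
    rewrite pHallE (subset_trans (pHall_sub sylQ)) //= (card_Hall sylQ).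
    rewrite -(Lagrange sTG) partnM ?indexg_gt0 ?cardG_gt0 //.
    by rewrite [(#|G : T|`_p)%N]part_p'nat ?muln1 // p'natE.
  have [g Gg defQ] := Sylow_trans sylP sylQG.
  have [b [c [Nb Cc def_g]]] : exists b, exists c,
      [/\ b \in N, c \in 'N_G(P) & g = (c * b)%g].
    have : g \in ('N_G(P) * N)%g.
      by rewrite normC ?defG // (subset_trans (subsetIl _ _) nNG).
    by case/mulsgP=> c b Cc Nb ->; exists b, c.
  have Qxb : (x ^ b)%g \in Q.
    have nPc : c \in 'N(P) by case/setIP: Cc.
    by rewrite defQ def_g conjsgM (normP nPc) memJ_conjg.
  rewrite -(groupJr x (subsetP sNT b Nb)); exact: (subsetP (pHall_sub sylQ)).
by rewrite /commg lamM ?groupV ?NJ // AE // -lamM ?groupV // mulVg lam1 eqxx.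
Qed.

(** * Degrees of irreducible representations *)

(** The sum [B] of the conjugates by [G] of a matrix of trace 1 commutes
    with the representation, so it is a scalar [a] by Schur's lemma, and taking
    traces gives [n * a = #|G|], which is nonzero in [F]. *)
Lemma p'group_irr_degree (F : closedFieldType) (gT : finGroupType)
    (G : {group gT}) n (rG : mx_representation F G n) :
  [pchar F]^'.-group G -> mx_irreducible rG -> (n%:R : F) != 0.
Proof.
move=> p'G irrG; have [n_gt0 _] := (mx_irrP rG).1 irrG.
pose i0 := Ordinal n_gt0; pose E : 'M[F]_n := delta_mx i0 i0.
pose B := \sum_(x in G) rG x^-1%g *m E *m rG x.
have trE : \tr E = 1.
  rewrite /mxtrace (bigD1 i0) //= big1 => [|i neq_i]; rewrite mxE ?eqxx ?addr0 //.
  by rewrite (negPf neq_i).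
have trB : \tr B = #|G|%:R.
  rewrite raddf_sum -sumr_const; apply: eq_bigr => x Gx /=.
  by rewrite mxtrace_mulC mulmxA -repr_mxM ?groupV // mulgV repr_mx1 mul1mx.
have cGB : centgmx rG B.
  apply/centgmxP=> y Gy; rewrite mulmx_suml mulmx_sumr.
  rewrite [RHS](reindex_acts 'R _ Gy) ?astabsR //=.
  apply: eq_bigr => x Gx; rewrite invMg !repr_mxM ?groupV // !mulmxA.
  by rewrite -(repr_mxM rG Gy (groupVr Gy)) mulgV repr_mx1 mul1mx.
have [a root_a] : exists a, root (char_poly B) a.
  have := size_char_poly B; rewrite eigenvaluesP size_prod_XsubC.
  case: (eigenvalues B) => [|a s] /=.
    by case=> n0; move: (n_gt0); rewrite -n0.
  by exists a; rewrite root_prod_XsubC mem_head.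
have Ba : B = a%:M.
  have cGBa : centgmx rG (B - a%:M).
    apply/centgmxP=> y Gy; rewrite mulmxBl mulmxBr -scalar_mxC.
    by rewrite (centgmxP cGB).
  apply/eqP; rewrite -subr_eq0; apply: contraT => /(mx_Schur irrG cGBa) unitB.
  move: root_a; rewrite -eigenvalue_root_char => /eigenvalueP[v va /eqP[]].
  by rewrite -(mulmxK unitB v) mulmxBr va mul_mx_scalar subrr mul0mx.
have: (#|G|%:R : F) != 0 by rewrite -pcharf'_nat.
by apply: contraNneq => n0; rewrite -trB Ba mxtrace_scalar -mulr_natr n0 mulr0.
Qed.

Lemma cfBrauer1 (F : closedFieldType) (theta : F -> algC) (p : nat)
    (gT : finGroupType) (G : {group gT}) n (rG : mx_representation F G n) :
  theta 1 = 1 -> cfBrauer p theta rG 1%g = n%:R.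
Proof.
move=> theta1; rewrite cfunE group1 p_elt1 mulr1n.
have -> : n%:R = (size (eigenvalues (rG 1%g)))%:R :> algC.
  congr _%:R; apply: succn_inj; rewrite -(size_prod_XsubC _ id) -eigenvaluesP.
  by rewrite size_char_poly.
rewrite -sum1_size natr_sum big_seq [RHS]big_seq.
apply: eq_bigr => a; rewrite -root_prod_XsubC -eigenvaluesP.
by move/(repr_unity_root (group1 G)); rewrite order1 expr1 => ->.
Qed.

Lemma normal_Sylow_irr_degree (F : closedFieldType) (p : nat)
    (gT : finGroupType) (G P : {group gT}) n (rG : mx_representation F G n) :
    p \in [pchar F] -> p.-Sylow(G) P -> P <| G -> mx_irreducible rG ->
  ~~ (p %| n)%N.
Proof.
move=> charF sylP nsPG irrG; rewrite (dvdn_pcharf charF).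
have krP : P \subset rker rG.
  rewrite -(normal_Hall_pcore sylP nsPG).
  exact: pcore_sub_rker_mx_irr_pchar charF _ _ _ irrG.
have nPG := normal_norm nsPG.
apply: (p'group_irr_degree (rG := quo_repr krP nPG)).
  rewrite (eq_pgroup _ (eq_negn (pcharf_eq charF))) /pgroup card_quotient //.
  by case/and3P: sylP.
exact/quo_mx_irr.
Qed.

(** * Monomial Brauer characters and normal Sylow subgroups *)

Theorem mainTheorem1 (gT : finGroupType) (G : {group gT}) (p : nat)
    (F : closedFieldType) (theta : F -> algC)
    (solG : solvable G) (p_prime : prime p) (charF : p \in [pchar F])
    (thetaP : brauer_lift theta) :
  (exists2 P : {group gT}, p.-Sylow(G) P & P <| G) <->
  (forall phi : 'CF(G), IBr p theta phi -> monomial_Brauer p theta phi ->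
     ~~ (p %| phi 1%g)%C).
Proof.
have theta1 : theta 1 = 1 by case: thetaP.
split=> [[P sylP nsPG] phi [n [rG irrG ->]] _ | monG].
  by rewrite cfBrauer1 // dvdC_nat (normal_Sylow_irr_degree charF sylP nsPG irrG).
exists 'O_p(G)%G; last exact: pcore_normal.
apply: (normal_Sylow_of_inertia_index charF solG) => N T f nsN sNT sTG f1 fM sep.
have irr_mu : IBr p theta (cfBrauer p theta (linmx_representation f1 fM)).
  exists 1%N; exists (linmx_representation f1 fM) => //.
  exact/mx_abs_irrW/linear_mx_abs_irr.
have mu1 : cfBrauer p theta (linmx_representation f1 fM) 1%g = 1.
  by rewrite cfBrauer1.
have def_phi := cfBrauer_indmx sTG f1 fM thetaP charF.
have := monG ('Ind[G] (cfBrauer p theta (linmx_representation f1 fM))).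
rewrite cfInd1 // mu1 mulr1 dvdC_nat; apply.
  rewrite -def_phi; exists #|G : T|, (indmx_representation sTG f1 fM) => //.
  exact: indmx_irr nsN sNT sep.
exists T; split=> //; exists (cfBrauer p theta (linmx_representation f1 fM)).
by split.
Qed.
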